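(* There exist a non-resonant torus homeomorphism $f:\mathbb{T}^2\to\mathbb{T}^2$ and a Cantor set $C\subset S^1$ such that $\Omega(f)=C\times S^1$ (where $\mathbb{T}^2=S^1\times S^1$) and $f|_{\Omega(f)}$ is not transitive.
   Context: $\mathbb{T}^2=\mathbb{R}^2/\mathbb{Z}^2=S^1\times S^1$. $\mathrm{Homeo}_0(\mathbb{T}^2)$ is the set of homeomorphisms of $\mathbb{T}^2$ homotopic to the identity. The rotation set of a lift $F:\mathbb{R}^2\to\mathbb{R}^2$ of $f\in\mathrm{Homeo}_0(\mathbb{T}^2)$ is the set of all limits of sequences $\frac{F^{n_i}(z_i)-z_i}{n_i}$ with $z_i\in\mathbb{R}^2$, $n_i\to+\infty$; changing the lift translates it by an integer vector. $f\in\mathrm{Homeo}_0(\mathbb{T}^2)$ is called non-resonant if its rotation set is a single vector $(\alpha,\beta)$ (defined modulo $\mathbb{Z}^2$) such that $1,\alpha,\beta$ are rationally independent (linearly independent over $\mathbb{Q}$). Equivalently, for every lift $F$ and every $z\in\mathbb{R}^2$, $\lim_{n\to\infty}\frac{F^n(z)-z}{n}=(\alpha,\beta)\ (\mathrm{mod}\ \mathbb{Z}^2)$ with $1,\alpha,\beta$ rationally independent. The non-wandering set $\Omega(f)$ is the set of points $x$ such that for every neighborhood $U$ of $x$ there exists $n>0$ with $f^n(U)\cap U\neq\emptyset$. For an $f$-invariant compact set $K$, $f|_K$ is transitive if for any two nonempty relatively open subsets $U,V$ of $K$ there exists $n>0$ with $f^n(U)\cap V\neq\emptyset$. *)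

(* Defs.v *)
From HB Require Import structures.
From mathcomp Require Import all_boot all_order all_algebra.
From mathcomp Require Import all_classical all_reals all_analysis.

Set Implicit Arguments.
Unset Strict Implicit.
Unset Printing Implicit Defensive.

Import Order.TTheory GRing.Theory Num.Theory.
Import numFieldNormedType.Exports.

Local Open Scope classical_set_scope.
Local Open Scope ring_scope.
Local Open Scope quotient_scope.

Definition eq_mod1 (R : realType) : rel R := fun x y => x - y \is a Num.int.

Lemma eq_mod1_refl (R : realType) : reflexive (@eq_mod1 R).
Proof. by move=> x; rewrite /eq_mod1 subrr rpred0. Qed.

Lemma eq_mod1_sym (R : realType) : symmetric (@eq_mod1 R).
Proof. by move=> x y; rewrite /eq_mod1 -opprB rpredN. Qed.

Lemma eq_mod1_trans (R : realType) : transitive (@eq_mod1 R).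
Proof.
move=> y x z xy yz.
by rewrite /eq_mod1 -(subrKA y) rpredD.
Qed.

Canonical eq_mod1_equiv (R : realType) : equiv_rel R :=
  EquivRel (@eq_mod1 R) (@eq_mod1_refl R) (@eq_mod1_sym R) (@eq_mod1_trans R).

Definition circle (R : realType) : Type :=
  quotient_topology {eq_quot (eq_mod1_equiv R)}.

HB.instance Definition _ (R : realType) := Topological.on (circle R).

Notation torus R := (circle R * circle R)%type.

Definition circle_proj (R : realType) (x : R) : circle R :=
  \pi_{eq_quot (eq_mod1_equiv R)} x.

Definition torus_proj (R : realType) (z : R * R) : torus R :=
  (circle_proj z.1, circle_proj z.2).

Definition homeomorphism (T U : topologicalType) (f : T -> U) : Prop :=
  continuous f /\
  exists g : U -> T, [/\ continuous g, cancel f g & cancel g f].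

Definition homotopic (R : realType) (T U : topologicalType) (f g : T -> U)
    : Prop :=
  exists H : R * T -> U,
    [/\ {within `[0, 1]%classic `*` setT, continuous H},
        (forall x, H (0, x) = f x) &
        (forall x, H (1, x) = g x)].

Definition Homeo0 (R : realType) (f : torus R -> torus R) : Prop :=
  homeomorphism f /\ homotopic R f id.

Definition is_lift (R : realType) (f : torus R -> torus R)
    (F : R * R -> R * R) : Prop :=
  continuous F /\ forall z, torus_proj (F z) = f (torus_proj z).

Definition mean_displacement (R : realType) (F : R * R -> R * R) (n : nat)
    (z : R * R) : R * R :=
  (((iter n F z).1 - z.1) / n%:R, ((iter n F z).2 - z.2) / n%:R).

Definition rotation_set (R : realType) (F : R * R -> R * R) : set (R * R) :=
  [set v | exists (n : nat -> nat) (z : nat -> R * R),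
     n i @[i --> \oo] --> \oo /\
     mean_displacement F (n i) (z i) @[i --> \oo] --> v].

Definition rationally_independent (R : realType) (a b : R) : Prop :=
  forall p q r : rat, ratr p + ratr q * a + ratr r * b = 0 ->
    [/\ p = 0, q = 0 & r = 0].

(* Two lifts of a map homotopic to the identity differ by an integer
   translation, which translates the rotation set by the same vector and
   preserves rational independence; so one lift is enough. *)
Definition non_resonant (R : realType) (f : torus R -> torus R) : Prop :=
  Homeo0 f /\
  exists (F : R * R -> R * R) (a b : R),
    [/\ is_lift f F, rotation_set F = [set (a, b)] &
        rationally_independent a b].

Definition nonwandering_set (T : topologicalType) (f : T -> T) : set T :=
  [set x | forall U : set T, nbhs x U ->
     exists2 n : nat, (0 < n)%N & (iter n f @` U) `&` U !=set0].

Definition transitive_on (T : topologicalType) (f : T -> T) (K : set T)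
    : Prop :=
  forall U V : set T, open U -> open V ->
    K `&` U !=set0 -> K `&` V !=set0 ->
    exists2 n : nat, (0 < n)%N & (iter n f @` (K `&` U)) `&` (K `&` V) !=set0.

Definition cantor_set (T : topologicalType) (C : set T) : Prop :=
  [/\ C !=set0, compact C, perfect_set C & totally_disconnected C].

(* Main.v *)
Require Import Defs.
From mathcomp Require Import all_boot all_order all_algebra.
From mathcomp Require Import all_classical all_reals all_analysis.
From mathcomp Require Import lra ring zify.

Set Implicit Arguments.
Unset Strict Implicit.
Unset Printing Implicit Defensive.

Import Order.TTheory GRing.Theory Num.Theory.
Import numFieldNormedType.Exports.

Local Open Scope classical_set_scope.
Local Open Scope ring_scope.
Local Open Scope quotient_scope.

(** The homeomorphism is a skew product over a Denjoy homeomorphism of the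
    circle whose fibre rotations are trivial over the minimal Cantor set.

    Take alpha and gamma such that 1, alpha and gamma are rationally
    independent. A Denjoy homeomorphism h of rotation number alpha is obtained
    from the rotation by alpha by blowing up countably many orbits to intervals,
    called gaps, the orbits of 0 and of gamma among them ([exists_blowup],
    [push]). The complement of the open gaps is a Cantor set C on which h is
    recurrent ([cantor_set_cantor_circle], [cantor_recurrent]). Collapsing the
    gaps semiconjugates h to the rotation. The indicator function of the arc
    from 0 to gamma (for general gamma, the integer-valued function
    floor t - floor (t - gamma)) pulls back to a function that is locally
    constant on C, because its discontinuities have been blown up; interpolating
    on the gaps gives a continuous function [twist] on the circle, and
    f (x, y) = (h x, y + twist x).

    - By equidistribution of the orbits of the rotation, the Birkhoff averages of
      [twist] converge to gamma uniformly ([equidistribution], [stair_mean]), so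
      that the rotation set is the point (alpha, gamma) ([rotation_set_f]).
    - Over C the function [twist] takes integer values, hence f is there the
      product of h and the identity. So every point over C is nonwandering, while
      the second coordinate is invariant, which excludes transitivity
      ([nonwandering_f], [not_transitive_f]).
    - Over a gap every point wanders, since the iterates of a gap are pairwise
      disjoint. *)

(** * Rational independence of 1, sqrt 2 and sqrt 3 *)

(** The p-adic valuation of the square of a rational number is even. *)
Lemma nonsquare_rat (p k : nat) (x : rat) :
  prime p -> odd (logn p k) -> x ^+ 2 != k%:R.
Proof.
move=> pp ok; apply/eqP => h.
have k0 : (0 < k)%N by case: k ok {h} => //; rewrite logn0.
have dn0 : (0 < `|denq x|)%N by rewrite absz_gt0 denq_neq0.
have E : (`|numq x| ^ 2 = k * `|denq x| ^ 2)%N.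
  have : (numq x)%:~R ^+ 2 = k%:R * ((denq x)%:~R ^+ 2) :> rat.
    by rewrite -h -[x in x ^+ 2 * _]divq_num_den expr_div_n divfK // expf_neq0 // intr_eq0 denq_neq0.
  move=> e; have e' : (numq x) ^+ 2 = k%:Z * (denq x) ^+ 2.
    by apply: (@intr_inj rat); rewrite !expr2 !intrM -!expr2.
  by have := congr1 absz e'; rewrite abszM !abszX.
have n0 : (0 < `|numq x|)%N.
  by rewrite lt0n; apply/eqP => z; move: E; rewrite z exp0n// => /esym/eqP; rewrite muln_eq0 expn_eq0; lia.
have := congr1 (logn p) E.
rewrite lognM ?expn_gt0 ?dn0 // !lognX => /(congr1 odd).
by rewrite oddD !oddM ok.
Qed.

(** Squaring p + q sqrt 2 = - r sqrt 3 leaves a rational multiple 2 p q of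
    sqrt 2, so p or q vanishes; what remains says that 6 or 3 is the square of a
    rational number. *)
Lemma rationally_independent_sqrt (R : realType) (p q r : rat) :
  ratr p + ratr q * Num.sqrt 2 + ratr r * Num.sqrt 3 = 0 :> R ->
  [/\ p = 0, q = 0 & r = 0].
Proof.
move=> h.
have s2 : Num.sqrt 2 ^+ 2 = 2 :> R by rewrite sqr_sqrtr.
have s3 : Num.sqrt 3 ^+ 2 = 3 :> R by rewrite sqr_sqrtr.
set a := Num.sqrt 2 in h s2; set b := Num.sqrt 3 in h s3.
have N2 (x : rat) : x ^+ 2 != 2 by apply: (@nonsquare_rat 2 2).
have N3 (x : rat) : x ^+ 2 != 3 by apply: (@nonsquare_rat 3 3).
have N6 (x : rat) : x ^+ 2 != 6 by apply: (@nonsquare_rat 2 6).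
have key (x y : rat) k : (forall z : rat, z ^+ 2 != k) -> x ^+ 2 = k * y ^+ 2 -> x = 0 /\ y = 0.
  move=> Nk e; have [y0|y0] := eqVneq y 0.
    by move: e; rewrite y0 expr0n mulr0 => /eqP; rewrite expf_eq0 /= => /eqP.
  have /eqP[] := Nk (x / y).
  by rewrite expr_div_n e mulfK // expf_neq0.
have E : ratr (p ^+ 2 + 2 * q ^+ 2 - 3 * r ^+ 2) + ratr (2 * p * q) * a = 0 :> R.
  rewrite rmorphB rmorphD /= !rmorphM /= !ratr_nat.
  have {}h : ratr p + ratr q * a = - (ratr r * b) by lra.
  have h2 : (ratr p + ratr q * a) ^+ 2 = ratr r ^+ 2 * b ^+ 2 by rewrite h; ring.
  have h3 : (ratr p + ratr q * a) ^+ 2 =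
      ratr p * ratr p + ratr q * ratr q * a ^+ 2 + 2 * ratr p * ratr q * a by ring.
  by move: h2; rewrite h3 s2 s3 => h2; lra.
have pq : p * q = 0.
  apply/eqP/negPn/negP => pq.
  have Y0 : 2 * p * q != 0 by rewrite -mulrA mulf_neq0.
  move: (p ^+ 2 + _ - _) (2 * p * q) E Y0 => X Y E Y0.
  have /eqP[] := N2 (X / Y).
  have Y0' : ratr Y != 0 :> R by rewrite fmorph_eq0.
  apply: (fmorph_inj (ratr : rat -> R)).
  rewrite rmorphXn /= fmorph_div ratr_nat -s2 -[LHS]/((ratr X / ratr Y) ^+ 2).
  have -> : ratr X = - (ratr Y * a) :> R by apply/eqP; rewrite -addr_eq0 E.
  by rewrite mulNr [_ * a]mulrC mulfK // sqrrN.
move: E; rewrite -mulrA pq mulr0 rmorph0 mul0r addr0 => /eqP.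
rewrite fmorph_eq0 subr_eq0 => /eqP E.
move/eqP: pq; rewrite mulf_eq0 => /orP[]/eqP z; move: E; rewrite z expr0n ?mulr0 ?addr0 ?add0r => E.
- by have [|/eqP] := key (2 * q) r 6 N6; [rewrite exprMn; lra|rewrite mulf_eq0 => /orP[]// /eqP].
- by have [] := key p r 3 N3.
Qed.

(** * Uniform equidistribution of the orbits of an irrational rotation *)
Section rotation.
Variables (R : realType) (alpha : R).

(** Pigeonhole principle: among M + 1 points of the orbit, two have fractional
    parts in the same interval of length 1 / M. *)
Lemma dirichlet (e : R) : 0 < e ->
  exists n (m : int), (0 < n)%N /\ `|n%:R * alpha + m%:~R| < e.
Proof.
move=> e0.
pose M := (Num.truncn (e^-1)).+1.
have Me : M%:R^-1 < e.
  by rewrite invf_plt ?posrE ?ltr0n //; exact: truncnS_gt.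
have M0 : 0 < M%:R :> R by rewrite ltr0n.
pose fr (k : nat) : R := k%:R * alpha - (Num.floor (k%:R * alpha))%:~R.
have fr01 k : 0 <= fr k < 1.
  have := floor_itv (k%:R * alpha); rewrite /fr intrD => /andP[]; lra.
have box (k : 'I_M.+1) : (Num.truncn (M%:R * fr k) < M)%N.
  have /andP[f0 f1] := fr01 k.
  have /andP[h _] := truncn_itv (mulr_ge0 (ltW M0) f0).
  by rewrite -(ltr_nat R) (le_lt_trans h) // gtr_pMr.
pose g (k : 'I_M.+1) := Ordinal (box k).
have /injectivePn[i [j ij gij]] : ~~ injectiveb g.
  by apply/negP => /injectiveP /leq_card; rewrite !card_ord ltnn.
wlog lt_ij : i j ij gij / (i < j)%N.
  move=> W; have [|ji|/val_inj E] := ltngtP i j; first exact: W.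
    by apply: (W j i) => //; rewrite eq_sym.
  by rewrite E eqxx in ij.
exists (j - i)%N, (Num.floor (i%:R * alpha) - Num.floor (j%:R * alpha)).
split; first by rewrite subn_gt0.
have /andP[fi0 fi1] := fr01 i; have /andP[fj0 fj1] := fr01 j.
have -> : (j - i)%:R * alpha + (Num.floor (i%:R * alpha) - Num.floor (j%:R * alpha))%:~R = fr j - fr i.
  by rewrite natrB 1?ltnW // rmorphB /fr /=; ring.
apply: lt_trans Me.
move/(congr1 val): gij => /= gij.
have /andP[a1 a2] := truncn_itv (mulr_ge0 (ltW M0) fi0).
have /andP[b1 b2] := truncn_itv (mulr_ge0 (ltW M0) fj0).
rewrite -(ltr_pM2l M0) divff ?gt_eqF // -[X in X * _](gtr0_norm M0) -normrM.
rewrite mulrBr ltr_norml; move: a1 a2 b1 b2; rewrite gij -!natr1; lra.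
Qed.

Hypothesis irr : forall n (m : int), (0 < n)%N -> n%:R * alpha + m%:~R != 0.

(** A nonzero return d of the orbit with |d| < e exists by [dirichlet]; its
    multiples, up to the first one that exceeds 1 in modulus, meet every interval
    of length e after an integer translation. *)
Lemma orbit_net (e : R) : 0 < e ->
  exists K, forall s, exists k (m : int), (k <= K)%N /\ s < k%:R * alpha + m%:~R < s + e.
Proof.
move=> e0; have [n [m [n0 de]]] := dirichlet e0.
have := irr m n0; move: de; set d := _ + _ => de d0.
have Nd : 0 < `|d| by rewrite normr_gt0.
pose J := (Num.truncn (`|d|^-1)).+1.
exists (J * n)%N => s.
have jump (r : R) : 0 <= r <= 1 -> exists2 j, (j <= J)%N & r < j%:R * `|d| <= r + `|d|.
  move=> /andP[r0 r1].
  have rd : 0 <= r / `|d| by rewrite divr_ge0 // ltW.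
  have /andP[] := truncn_itv rd.
  rewrite ler_pdivlMr // ltr_pdivrMr // -natr1 => h1 h2.
  exists (Num.truncn (r / `|d|)).+1; last by rewrite -natr1 h2 /= mulrDl mul1r lerD2r.
  rewrite ltnS; apply: le_truncn; rewrite -[leRHS]mul1r ler_pM2r ?invr_gt0 //.
have [dp|dn] : 0 < d \/ d < 0 by apply/orP; rewrite -neq_lt eq_sym.
  have [|j jJ] := jump (s - (Num.floor s)%:~R).
    have := floor_itv s; rewrite intrD => /andP[]; lra.
  rewrite gtr0_norm // in de *; move=> jd.
  exists (j * n)%N, (m *+ j + Num.floor s); split; first by rewrite leq_mul2r jJ orbT.
  have -> : (j * n)%:R * alpha + (m *+ j + Num.floor s)%:~R = j%:R * d + (Num.floor s)%:~R.
    by rewrite /d natrM intrD rmorphMn /= -mulr_natl; ring.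
  by move: jd de => /andP[]; lra.
have [|j jJ] := jump ((Num.floor (s + e))%:~R + 1 - (s + e)).
  have := floor_itv (s + e); rewrite intrD => /andP[]; lra.
rewrite ltr0_norm // in de *; move=> jd.
exists (j * n)%N, (m *+ j + (Num.floor (s + e) + 1)); split; first by rewrite leq_mul2r jJ orbT.
have -> : (j * n)%:R * alpha + (m *+ j + (Num.floor (s + e) + 1))%:~R
    = j%:R * d + (Num.floor (s + e))%:~R + 1.
  by rewrite /d natrM !intrD rmorphMn /= -mulr_natl; ring.
by move: jd de => /andP[]; lra.
Qed.

Definition floor_sum (n : nat) (t : R) : R :=
  \sum_(k < n) (Num.floor (t + k%:R * alpha))%:~R.

Lemma floor_sum_le n : {homo floor_sum n : s t / s <= t}.
Proof. by move=> s t st; apply: ler_sum => k _; rewrite ler_int le_floor // lerD2r. Qed.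

Lemma floor_sum_int n t (m : int) : floor_sum n (t + m%:~R) = floor_sum n t + n%:R * m%:~R.
Proof.
rewrite /floor_sum -[n in n%:R]card_ord mulr_natl -sumr_const -big_split /=.
by apply: eq_bigr => k _; rewrite addrAC floorDrz ?intr_int // intrKfloor intrD.
Qed.

(** The sum telescopes along the orbit. *)
Lemma floor_sum_step n t : floor_sum n (t + alpha) <= floor_sum n t + n%:R * alpha + 1.
Proof.
have -> : floor_sum n (t + alpha) = floor_sum n t
    + (Num.floor (t + n%:R * alpha))%:~R - (Num.floor t)%:~R.
  rewrite /floor_sum; elim: n => [|n IH]; first by rewrite !big_ord0 mul0r addr0 add0r subrr.
  rewrite !big_ord_recr /= IH.
  have -> : t + alpha + n%:R * alpha = t + n.+1%:R * alpha by rewrite -natr1; ring.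
  ring.
have := floor_itv t; have := floor_itv (t + n%:R * alpha); rewrite !intrD.
by move=> /andP[? ?] /andP[? ?]; lra.
Qed.

Lemma floor_sum_iter n t k : floor_sum n (t + k%:R * alpha) <= floor_sum n t + k%:R * (n%:R * alpha + 1).
Proof.
elim: k => [|k IH]; first by rewrite !mul0r !addr0.
have -> : t + k.+1%:R * alpha = t + k%:R * alpha + alpha by rewrite -natr1; ring.
have := floor_sum_step n (t + k%:R * alpha); rewrite -natr1; lra.
Qed.

(** The function floor_sum n t - n t increases by a bounded amount under a bounded
    number of rotation steps ([floor_sum_iter]), is invariant under integer
    translations, and floor_sum n is nondecreasing in t. A bounded number of steps
    carries t into the interval [s, s + e / 2] modulo 1 ([orbit_net]), so that the
    values at s and at t differ by at most n e / 2 plus a constant. *)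
Lemma equidistribution (e : R) : 0 < e ->
  exists N, forall n, (N <= n)%N -> forall s t, floor_sum n s - floor_sum n t <= n%:R * (s - t + e).
Proof.
move=> e0; have e20 : 0 < e / 2 by lra.
have [K net] := orbit_net e20.
exists (Num.truncn (K%:R / (e / 2))).+1 => n nN s t.
have Kn : K%:R <= n%:R * (e / 2).
  rewrite -ler_pdivrMr //; apply: ltW; rewrite (lt_le_trans (truncnS_gt _)) // ler_nat //.
have [k [m [kK /andP[h1 h2]]]] := net (s - t).
have /(floor_sum_le n) : s <= t + k%:R * alpha + m%:~R by lra.
rewrite floor_sum_int; have := floor_sum_iter n t k; rewrite -(ler_nat R) in kK.
have : n%:R * (k%:R * alpha + m%:~R) <= n%:R * (s - t + e / 2) by rewrite ler_wpM2l // ltW.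
by lra.
Qed.

End rotation.

(** * A strictly increasing function with comparable jumps along orbits *)
Lemma add_int_morph (R : realType) (f : R -> R) :
  (forall t, f (t + 1) = f t + 1) -> forall t (m : int), f (t + m%:~R) = f t + m%:~R.
Proof.
move=> f1 t m; have fnat s n : f (s + n%:R) = f s + n%:R.
  by elim: n => [|n IH]; rewrite ?addr0// -natr1 !addrA f1 IH.
case: m => n; first exact: fnat.
by rewrite NegzE mulrNz; apply/eqP; rewrite eq_sym subr_eq -fnat subrK.
Qed.

Section staircase.
Variables (R : realType) (alpha gamma : R).

(** Half of a degree one function: linear, for strict monotonicity, plus steps at
    the points congruent to 0 and to gamma. *)
Definition source (t : R) : R :=
  t / 4 + ((Num.floor t)%:~R + (Num.floor (t - gamma))%:~R) / 8.

Definition relax (u : R -> R) (t : R) : R :=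
  source t + (u (t + alpha) + u (t - alpha)) / 4.

Lemma source1 t : source (t + 1) = source t + 1 / 2.
Proof.
have f1 (x : R) : (Num.floor (x + 1))%:~R = (Num.floor x)%:~R + 1 :> R.
  by rewrite floorDrz ?rpred1 // floor1 intrD.
by rewrite /source [t + 1 - _]addrAC !f1; lra.
Qed.

Lemma source_lt s t : s < t -> (t - s) / 4 <= source t - source s.
Proof.
move=> st; have f1 : (Num.floor s)%:~R <= (Num.floor t)%:~R :> R.
  by rewrite ler_int le_floor // ltW.
have f2 : (Num.floor (s - gamma))%:~R <= (Num.floor (t - gamma))%:~R :> R.
  by rewrite ler_int le_floor // lerD2r ltW.
by rewrite /source; lra.
Qed.

Lemma source_jump s t r : s < r < t -> r = 0 \/ r = gamma -> 1 / 8 <= source t - source s.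
Proof.
move=> /andP[sr rt] rE; have st := lt_trans sr rt.
have jump (x y z : R) (m : int) : x < z -> z < y -> z = m%:~R -> (Num.floor x)%:~R + 1 <= (Num.floor y)%:~R :> R.
  move=> xz zy zm; rewrite -[1]/(1%:~R) -intrD ler_int.
  apply: (@le_trans _ _ m); last by rewrite floor_ge_int -zm ltW.
  by rewrite lezD1 -(ltr_int R) -zm (le_lt_trans _ xz) // floor_le.
have f1 : (Num.floor s)%:~R <= (Num.floor t)%:~R :> R.
  by rewrite ler_int le_floor // ltW.
have f2 : (Num.floor (s - gamma))%:~R <= (Num.floor (t - gamma))%:~R :> R.
  by rewrite ler_int le_floor // lerD2r ltW.
case: rE => rE.
  by have := jump s t r 0 sr rt rE; rewrite /source; lra.
rewrite -rE in f2.
have := jump (s - r) (t - r) (r - r) 0; rewrite !ltrD2r subrr => /(_ sr rt erefl).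
by rewrite /source -rE; lra.
Qed.

(* large enough for source to stay within c / 2 of t / 2 *)
Let c := 2 + `|gamma|.

Let approx n := iter n relax (fun t => t - c).

Lemma relax_homo (u v : R -> R) : (forall t, u t <= v t) -> forall t, relax u t <= relax v t.
Proof. by move=> uv t; rewrite /relax; have := uv (t + alpha); have := uv (t - alpha); lra. Qed.

Lemma source_bound t : t / 2 - c / 2 <= source t <= t / 2 + c / 2.
Proof.
rewrite /source /c; have := floor_itv t; have := floor_itv (t - gamma).
have := ler_norm gamma; have := ler_norm (- gamma); rewrite normrN !intrD.
by move=> ? ? /andP[? ?] /andP[? ?]; lra.
Qed.

Lemma approx_incr n t : approx n t <= approx n.+1 t.
Proof.
elim: n t => [|n IH] t; last exact: relax_homo.
by rewrite /approx /= /relax; have /andP[h _] := source_bound t; lra.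
Qed.

Lemma approx_bound n t : t - c <= approx n t <= t + c.
Proof.
elim: n t => [|n IH] t; first by rewrite /approx /c /=; have := normr_ge0 gamma; lra.
have := IH (t + alpha); have := IH (t - alpha); have := source_bound t.
by rewrite /approx /= -/(approx n) /relax; lra.
Qed.

Lemma approx1 n t : approx n (t + 1) = approx n t + 1.
Proof.
elim: n t => [|n IH] t; first by rewrite /approx /=; lra.
rewrite /approx /= -/(approx n) /relax source1 [t + 1 + _]addrAC [t + 1 - _]addrAC !IH; lra.
Qed.

Lemma approx_homo n : {homo approx n : s t / s <= t}.
Proof.
elim: n => [|n IH] s t st; first by rewrite /approx /=; lra.
have h1 : approx n (s + alpha) <= approx n (t + alpha) by apply: IH; lra.
have h2 : approx n (s - alpha) <= approx n (t - alpha) by apply: IH; lra.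
rewrite /approx /= -/(approx n) /relax.
move: st; rewrite le_eqVlt => /predU1P[->//|st].
by have := source_lt st; lra.
Qed.

(** The fixed point is the limit of the iterates of [relax] on t - c, which
    increase because t - c is a subsolution and stay below the supersolution
    t + c. The equation L = relax L is what matters below: the increments of L
    dominate a quarter of the increments of its translates by alpha and - alpha, so
    the set of its jumps is invariant under the rotation. *)
Lemma exists_staircase : exists L : R -> R,
  [/\ forall t, L t = relax L t,
      forall t, L (t + 1) = L t + 1 &
      {homo L : s t / s < t}].
Proof.
pose L t := limn (approx ^~ t).
have cv t : approx n t @[n --> \oo] --> L t.
  apply: (@nondecreasing_is_cvgn _ (approx ^~ t)).
    by apply/nondecreasing_seqP => n; exact: approx_incr.
  by exists (t + c) => _ [n _ <-]; have /andP[] := approx_bound n t.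
have LE t : L t = relax L t.
  apply: (cvg_lim (@Rhausdorff R)); rewrite -cvg_shiftS /=.
  apply: cvgD; first exact: cvg_cst.
  by apply: cvgMl; apply: cvgD.
have Lle s t : s <= t -> L s <= L t.
  by move=> st; apply: ler_cvg_to (cv s) (cv t) _; apply: nearW => n; exact: approx_homo.
exists L; split => //.
- move=> t; apply: (cvg_lim (@Rhausdorff R)).
  under eq_fun do rewrite approx1.
  exact: cvgD (cv t) (cvg_cst _).
- move=> s t st; rewrite LE [ltRHS]LE /relax.
  have := source_lt st.
  have : L (s + alpha) <= L (t + alpha) by apply: Lle; lra.
  have : L (s - alpha) <= L (t - alpha) by apply: Lle; lra.
  by lra.
Qed.

End staircase.

(** * Blowing up orbits of a rotation *)

(** The point t of the line is replaced by the interval from lo t to hi t, which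
    is a single point unless t is blown up, and phi collapses these intervals. The
    last field says that the set of blown up points is invariant under translation
    by alpha. *)
Record blowup (R : realType) (alpha : R) := Blowup {
  lo : R -> R;
  hi : R -> R;
  phi : R -> R;
  lo_hi : forall t, lo t <= hi t;
  hi_lo : forall s t, s < t -> hi s < lo t;
  phiP : forall x, lo (phi x) <= x <= hi (phi x);
  lo1 : forall t, lo (t + 1) = lo t + 1;
  hi1 : forall t, hi (t + 1) = hi t + 1;
  gapD : forall t, (lo (t + alpha) < hi (t + alpha)) = (lo t < hi t)
}.

Definition left_limit (R : realType) (L : R -> R) t := sup (L @` [set s | s < t]).

Definition right_limit (R : realType) (L : R -> R) t := inf (L @` [set s | t < s]).

Definition level (R : realType) (L : R -> R) x := sup [set t | L t <= x].

Section one_sided_limits.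
Variables (R : realType) (L : R -> R).
Hypothesis L1 : forall t, L (t + 1) = L t + 1.
Hypothesis Llt : {homo L : s t / s < t}.

Local Notation lo := (left_limit L).
Local Notation hi := (right_limit L).
Local Notation phi := (level L).

Let Lle s t : s <= t -> L s <= L t.
Proof. by rewrite le_eqVlt => /predU1P[->//|/Llt/ltW]. Qed.

Let L_int t (m : int) : L (t + m%:~R) = L t + m%:~R.
Proof. exact: add_int_morph. Qed.

Lemma le_left_limit s t : s < t -> L s <= lo t.
Proof.
move=> st; apply: ub_le_sup; last by exists s.
by exists (L t) => _ [r /= rt <-]; apply: ltW; exact: Llt.
Qed.

Lemma left_limit_le t z : (forall s, s < t -> L s <= z) -> lo t <= z.
Proof.
move=> h; apply: ge_sup; first by exists (L (t - 1)), (t - 1) => //=; lra.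
by move=> _ [r /= rt <-]; exact: h.
Qed.

Lemma right_limit_le s t : t < s -> hi t <= L s.
Proof.
move=> st; apply: ge_inf; last by exists s.
by exists (L t) => _ [r /= rt <-]; apply: ltW; exact: Llt.
Qed.

Lemma le_right_limit t z : (forall s, t < s -> z <= L s) -> z <= hi t.
Proof.
move=> h; apply: lb_le_inf; first by exists (L (t + 1)), (t + 1) => //=; lra.
by move=> _ [r /= rt <-]; exact: h.
Qed.

(** All bounds on the size of a jump follow from bounds on the increments across
    it. *)
Lemma jump_ge t d : (forall s s', s < t < s' -> d <= L s' - L s) -> d <= hi t - lo t.
Proof.
move=> h; suff : lo t <= hi t - d by lra.
apply: left_limit_le => s st; suff : L s + d <= hi t by lra.
apply: le_right_limit => s' ts'; have := h s s'; rewrite st ts' => /(_ isT); lra.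
Qed.

Let bnd x : (exists t, L t <= x) /\ (forall t, L t <= x -> t <= x - L 0 + 1).
Proof.
split.
  exists (Num.floor (x - L 0))%:~R; rewrite -[X in L X]add0r L_int.
  by have := floor_itv (x - L 0) => /andP[]; lra.
move=> t tx; have /andP[h1 h2] := floor_itv t; rewrite intrD in h2.
have := Lle h1; rewrite -[X in L X <= _]add0r L_int; lra.
Qed.

Let phi_ge x t : L t <= x -> t <= phi x.
Proof.
move=> h; apply: ub_le_sup => //; exists (x - L 0 + 1) => s; exact: (bnd x).2.
Qed.

Let phi_gt x t : t < phi x -> L t <= x.
Proof.
move=> h; have [t' /=] := @sup_gt _ [set t | L t <= x] t (bnd x).1 h.
by move=> h1 /Llt h2; apply: le_trans h1; exact: ltW.
Qed.

Lemma left_limit_le_right t : lo t <= hi t.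
Proof.
rewrite -subr_ge0; apply: jump_ge => s s' /andP[st ts'].
by rewrite subr_ge0 ltW // Llt // (lt_trans st).
Qed.

Lemma right_limit_lt_left s t : s < t -> hi s < lo t.
Proof.
move=> st; have s1 : s < s + (t - s) / 3 by lra.
apply: le_lt_trans (right_limit_le s1) _.
have s2 : s + 2 * (t - s) / 3 < t by lra.
by apply: lt_le_trans (le_left_limit s2); apply: Llt; lra.
Qed.

Lemma level_itv x : lo (phi x) <= x <= hi (phi x).
Proof.
rewrite left_limit_le //=; last exact: phi_gt.
by apply: le_right_limit => s xs; rewrite leNgt; apply/negP => /ltW /phi_ge; rewrite leNgt xs.
Qed.

Lemma left_limit1 t : lo (t + 1) = lo t + 1.
Proof.
apply/eqP; rewrite eq_le; apply/andP; split.
  apply: left_limit_le => s st; have := @le_left_limit (s - 1) t; have := L1 (s - 1).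
  by rewrite subrK => ->; rewrite lerD2r; apply; lra.
rewrite -lerBrDr; apply: left_limit_le => s st; rewrite lerBrDr -L1; apply: le_left_limit; lra.
Qed.

Lemma right_limit1 t : hi (t + 1) = hi t + 1.
Proof.
apply/eqP; rewrite eq_le; apply/andP; split.
  rewrite -lerBlDr; apply: le_right_limit => s st; rewrite lerBlDr -L1; apply: right_limit_le; lra.
apply: le_right_limit => s st; have := @right_limit_le (s - 1) t; have := L1 (s - 1).
by rewrite subrK => ->; rewrite lerD2r; apply; lra.
Qed.

Lemma jump_comparable a t :
  (forall s s', s < s' -> L (s' + a) - L (s + a) <= 4 * (L s' - L s)) ->
  lo (t + a) < hi (t + a) -> lo t < hi t.
Proof.
move=> h; rewrite -subr_gt0 => g; rewrite -subr_gt0.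
apply: (@lt_le_trans _ _ ((hi (t + a) - lo (t + a)) / 4)); first by lra.
apply: jump_ge => s s' /andP[st ts'].
have := h _ _ (lt_trans st ts').
have : L (s + a) <= lo (t + a) by apply: le_left_limit; lra.
have : hi (t + a) <= L (s' + a) by apply: right_limit_le; lra.
by lra.
Qed.

End one_sided_limits.

(** The blow-up inserts the jumps of the function of [exists_staircase]. *)
Lemma exists_blowup (R : realType) (alpha gamma : R) :
  exists B : blowup alpha, lo B 0 < hi B 0 /\ lo B gamma < hi B gamma.
Proof.
have [L [LE L1 Llt]] := exists_staircase alpha gamma.
have Lle s t : s <= t -> L s <= L t.
  by rewrite le_eqVlt => /predU1P[->//|/Llt/ltW].
have cmp s t : s < t -> source gamma t - source gamma s
   + (L (t + alpha) - L (s + alpha)) / 4 + (L (t - alpha) - L (s - alpha)) / 4 <= L t - L s.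
  by move=> st; rewrite [L t]LE [L s]LE /relax; lra.
have cmpD s t : s < t -> L (t + alpha) - L (s + alpha) <= 4 * (L t - L s).
  move=> st; have := cmp s t st; have := source_lt gamma st.
  have : L (s - alpha) <= L (t - alpha) by apply: Lle; lra.
  by lra.
have cmpB s t : s < t -> L (t - alpha) - L (s - alpha) <= 4 * (L t - L s).
  move=> st; have := cmp s t st; have := source_lt gamma st.
  have : L (s + alpha) <= L (t + alpha) by apply: Lle; lra.
  by lra.
have gapE t : (left_limit L (t + alpha) < right_limit L (t + alpha))
    = (left_limit L t < right_limit L t).
  apply/idP/idP; first exact: (jump_comparable Llt cmpD).
  by have := @jump_comparable _ L Llt (- alpha) (t + alpha) cmpB; rewrite addrK.
exists (Blowup (left_limit_le_right Llt) (right_limit_lt_left Llt) (level_itv L1 Llt) 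
  (left_limit1 L1 Llt) (right_limit1 L1 Llt) gapE).
have gap r : r = 0 \/ r = gamma -> left_limit L r < right_limit L r.
  move=> rE; rewrite -subr_gt0; apply: (@lt_le_trans _ _ (1 / 8)); first by lra.
  apply: jump_ge => s s' srs; have /andP[sr rs] := srs.
  have := cmp s s' (lt_trans sr rs); have := source_jump srs rE.
  have : L (s - alpha) <= L (s' - alpha) by apply: Lle; lra.
  have : L (s + alpha) <= L (s' + alpha) by apply: Lle; lra.
  by lra.
by split; apply: gap; [left|right].
Qed.

(** * The Denjoy homeomorphism *)
Lemma homo_surj_continuous (R : realType) (f : R -> R) :
  {homo f : x y / x <= y} -> (forall y, exists x, f x = y) -> continuous f.
Proof.
move=> fle fs x; apply/cvgrPdist_lt => e e0.
have [u fu] := fs (f x - e / 2); have [v fv] := fs (f x + e / 2).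
have ux : u < x by rewrite ltNge; apply/negP => /fle; rewrite fu; lra.
have xv : x < v by rewrite ltNge; apply/negP => /fle; rewrite fv; lra.
have : \forall y \near x, u < y < v.
  near=> y; apply/andP; split; near: y; [exact: lt_nbhsr|exact: lt_nbhsl].
apply: filterS => y /andP[/ltW/fle uy /ltW/fle yv].
by rewrite ltr_norml; move: uy yv; rewrite fu fv; lra.
Unshelve. all: by end_near. Qed.

Lemma floor_itv01 (R : realType) (x : R) : 0 <= x < 1 -> Num.floor x = 0.
Proof. by move=> h; apply: floor_def; rewrite add0r. Qed.

Section blowup_theory.
Variables (R : realType) (alpha : R) (B : blowup alpha).
Local Notation lo := (lo B).
Local Notation hi := (hi B).
Local Notation phi := (phi B).

Lemma lo_int t (m : int) : lo (t + m%:~R) = lo t + m%:~R.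
Proof. exact/add_int_morph/lo1. Qed.

Lemma hi_int t (m : int) : hi (t + m%:~R) = hi t + m%:~R.
Proof. exact/add_int_morph/hi1. Qed.

Lemma phi_eq t x : lo t <= x <= hi t -> phi x = t.
Proof.
move=> /andP[h1 h2]; have /andP[p1 p2] := phiP B x.
by case: (ltgtP (phi x) t) => // /(hi_lo B); lra.
Qed.

Lemma phi_le : {homo phi : x y / x <= y}.
Proof.
move=> x y xy; rewrite leNgt; apply/negP => /(hi_lo B).
by have /andP[_ h] := phiP B y; have /andP[h' _] := phiP B x; lra.
Qed.

Lemma phi_int x (m : int) : phi (x + m%:~R) = phi x + m%:~R.
Proof. by apply: phi_eq; rewrite lo_int hi_int !lerD2r; exact: phiP. Qed.

Lemma phi_lo t : phi (lo t) = t.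
Proof. by apply: phi_eq; rewrite lexx lo_hi. Qed.

Lemma phi_hi t : phi (hi t) = t.
Proof. by apply: phi_eq; rewrite lexx lo_hi. Qed.

(** Collapsing the gaps commutes with integer translations, so it stays at bounded
    distance from the identity. *)
Lemma phi_near x : `|phi x - x| <= `|phi 0| + 1.
Proof.
have /andP[h1 h2] := floor_itv x; rewrite intrD in h2.
have := phi_le h1; have := phi_le (ltW h2).
rewrite -[(Num.floor x)%:~R]add0r -addrA -intrD !phi_int intrD => p1 p2.
have := ler_norm (phi 0); have := ler_norm (- phi 0); rewrite normrN => n1 n2.
by rewrite ler_norml; lra.
Qed.

Definition gap_width t := hi t - lo t.

(** The lift of the translation by a: the interval over t is mapped affinely onto
    the interval over t + a. When the former is a point, the quotient is 0 / 0 = 0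
    and the latter is a point as well. *)
Definition push a x := lo (phi x + a) + (x - lo (phi x)) * (gap_width (phi x + a) / gap_width (phi x)).

Lemma gap_width_ge0 t : 0 <= gap_width t.
Proof. by rewrite subr_ge0 lo_hi. Qed.

Section push.
Variable a : R.
Hypothesis ga : forall t, (lo (t + a) < hi (t + a)) = (lo t < hi t).

Let gap_width_eq0 t : (gap_width (t + a) == 0) = (gap_width t == 0).
Proof.
have E s : (gap_width s == 0) = ~~ (lo s < hi s).
  by rewrite /gap_width subr_eq0 -leNgt eq_le lo_hi andbT.
by rewrite !E ga.
Qed.

Lemma push_itv x : lo (phi x + a) <= push a x <= hi (phi x + a).
Proof.
have /andP[h1 h2] := phiP B x; rewrite /push; set t := phi x.
have w0 : 0 <= gap_width (t + a) / gap_width t by rewrite divr_ge0 ?gap_width_ge0.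
rewrite lerDl mulr_ge0 ?subr_ge0 //=.
rewrite -lerBrDl -/(gap_width (t + a)).
have [z|nz] := eqVneq (gap_width t) 0; first by rewrite z invr0 !mulr0 gap_width_ge0.
rewrite mulrCA ler_piMr ?gap_width_ge0 // ler_pdivrMr ?mul1r ?lerD2r //.
by rewrite lt_neqAle eq_sym nz gap_width_ge0.
Qed.

Lemma phi_push x : phi (push a x) = phi x + a.
Proof. by apply: phi_eq; exact: push_itv. Qed.

Lemma push_le : {homo push a : x y / x <= y}.
Proof.
move=> x y xy; have := phi_le xy; rewrite le_eqVlt => /predU1P[E|lt].
  by rewrite /push E lerD2l ler_wpM2r ?lerD2r // divr_ge0 ?gap_width_ge0.
have /andP[_ h1] := push_itv x; have /andP[h2 _] := push_itv y.
by have : hi (phi x + a) < lo (phi y + a) by [apply: hi_lo; rewrite ltrD2r]; lra.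
Qed.

Lemma push_int x (m : int) : push a (x + m%:~R) = push a x + m%:~R.
Proof.
have w t : gap_width (t + m%:~R) = gap_width t by rewrite /gap_width lo_int hi_int; ring.
by rewrite /push phi_int [_ + m%:~R + a]addrAC !w !lo_int; ring.
Qed.

Lemma push_lo t : push a (lo t) = lo (t + a).
Proof. by rewrite /push phi_lo subrr mul0r addr0. Qed.

Lemma push_hi t : push a (hi t) = hi (t + a).
Proof.
rewrite /push phi_hi -/(gap_width t).
have [z|nz] := eqVneq (gap_width t) 0.
  by rewrite z mul0r addr0; apply/eqP; have := gap_width_eq0 t; rewrite z eqxx subr_eq0 eq_sym => ->.
by rewrite mulrCA mulfV // mulr1 /gap_width addrC subrK.
Qed.

Lemma pushK : cancel (push a) (push (- a)).
Proof.
move=> x; have py := phi_push x; 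
have yE : push a x = lo (phi x + a) + (x - lo (phi x)) * (gap_width (phi x + a) / gap_width (phi x)) by [].
rewrite {1}/push py addrK yE addrAC subrr add0r.
have [z|nz] := eqVneq (gap_width (phi x)) 0.
  have /andP[h1 h2] := phiP B x; rewrite z invr0 !(mulr0, mul0r) addr0.
  by move: z; rewrite /gap_width; lra.
have nz' : gap_width (phi x + a) != 0 by rewrite gap_width_eq0.
by field; rewrite nz nz'.
Qed.

Lemma cantor_push x : x = lo (phi x) \/ x = hi (phi x) ->
  push a x = lo (phi (push a x)) \/ push a x = hi (phi (push a x)).
Proof.
by rewrite phi_push => -[xE|xE]; [left; rewrite {1}xE push_lo|right; rewrite {1}xE push_hi].
Qed.

End push.

Lemma gapDN t : (lo (t - alpha) < hi (t - alpha)) = (lo t < hi t).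
Proof. by rewrite -[in RHS](subrK alpha t) gapD. Qed.

Local Notation H := (push alpha).
Local Notation K := (push (- alpha)).

Lemma push_alphaK : cancel H K. Proof. exact: pushK (@gapD _ _ B). Qed.

Lemma push_oppK : cancel K H.
Proof. by move=> x; rewrite -[X in push X](opprK alpha) (pushK gapDN). Qed.

Lemma push_alpha_continuous : continuous H.
Proof.
by apply: homo_surj_continuous => [|y]; [exact: push_le|exists (K y); exact: push_oppK].
Qed.

Lemma push_opp_continuous : continuous K.
Proof.
by apply: homo_surj_continuous => [|y]; [exact: push_le|exists (H y); exact: push_alphaK].
Qed.

Lemma phi_iter_push n x : phi (iter n H x) = phi x + n%:R * alpha.
Proof.
elim: n => [|n IH]; first by rewrite mul0r addr0.
by rewrite iterS phi_push IH -natr1; ring.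
Qed.

Lemma iter_push_near n x : `|iter n H x - x - n%:R * alpha| <= 2 * (`|phi 0| + 1).
Proof.
have -> : iter n H x - x - n%:R * alpha =
    (phi x - x) - (phi (iter n H x) - iter n H x) by rewrite phi_iter_push; ring.
apply: le_trans (ler_normB _ _) _.
by have := phi_near x; have := phi_near (iter n H x); lra.
Qed.

Lemma iter_push_lo n t : iter n H (lo t) = lo (t + n%:R * alpha).
Proof.
elim: n => [|n IH]; first by rewrite mul0r addr0.
by rewrite iterS IH push_lo -natr1; congr lo; ring.
Qed.

(** * Staircases and their Birkhoff averages *)

(** A continuous version of floor (phi x - t) when t is blown up: it rises
    linearly from - 1 to 0 on the gap over t, is constant up to the gap over
    t + 1, and commutes with integer translations. *)
Definition stair t x : R :=
  let k := (Num.floor (x - lo t))%:~R in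
  k + Num.min 1 ((x - lo t - k) / gap_width t) - 1.

Section stair.
Variable t : R.
Hypothesis gt : lo t < hi t.

Let w0 : 0 < gap_width t. Proof. by rewrite subr_gt0. Qed.

Lemma stair_int x (m : int) : stair t (x + m%:~R) = stair t x + m%:~R.
Proof.
rewrite /stair (_ : x + m%:~R - lo t = x - lo t + m%:~R); last by ring.
rewrite floorDrz ?intr_int // intrKfloor intrD.
by rewrite [_ + m%:~R - _](_ : _ = x - lo t - (Num.floor (x - lo t))%:~R); ring.
Qed.

Lemma stair_itv x : (Num.floor (x - lo t))%:~R - 1 <= stair t x <= (Num.floor (x - lo t))%:~R.
Proof.
rewrite /stair; have /andP[h _] := floor_itv (x - lo t); rewrite -subr_ge0 in h.
have : 0 <= Num.min 1 ((x - lo t - (Num.floor (x - lo t))%:~R) / gap_width t).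
  by rewrite le_min ler01 divr_ge0 // ltW.
have : Num.min 1 ((x - lo t - (Num.floor (x - lo t))%:~R) / gap_width t) <= 1 by rewrite ge_min lexx.
by lra.
Qed.

Lemma stair_le : {homo stair t : x y / x <= y}.
Proof.
move=> x y xy; have : (Num.floor (x - lo t) <= Num.floor (y - lo t))%R.
  by apply: le_floor; rewrite lerD2r.
rewrite le_eqVlt => /predU1P[E|].
  rewrite /stair E lerD2r lerD2l le_min ge_min lexx /= ge_min; apply/orP; right.
  by rewrite ler_pM2r ?invr_gt0 //; lra.
rewrite -lezD1 -(ler_int R) intrD.
by have /andP[_ h1] := stair_itv x; have /andP[h2 _] := stair_itv y; lra.
Qed.

Lemma stair_flat x : hi t <= x <= lo t + 1 -> stair t x = 0.
Proof.
move=> /andP[h1 h2].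
have hl : hi t < lo t + 1 by rewrite -lo1; apply: hi_lo; lra.
have s0 z : hi t <= z < lo t + 1 -> stair t z = 0.
  move=> /andP[z1 z2].
  have E : Num.floor (z - lo t) = 0 by apply: floor_itv01; move: gt z1 z2; lra.
  rewrite /stair E subr0 add0r min_l ?subrr // ler_pdivlMr // mul1r /gap_width; lra.
move: h2; rewrite le_eqVlt => /predU1P[->|h2]; last by apply: s0; rewrite h1.
rewrite -[1]/(1%:~R) stair_int /stair subrr floor0 subr0 mul0r min_r // ?ler01 //; ring.
Qed.

Lemma stair_surj y : exists x, stair t x = y.
Proof.
have /andP[h1 h2] := floor_itv y; rewrite intrD in h2.
have hl : gap_width t < 1.
  by rewrite /gap_width ltrBlDl -lo1; apply: hi_lo; lra.
pose r := y - (Num.floor y)%:~R.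
exists (lo t + r * gap_width t + (Num.floor y + 1)%:~R).
have r0 : 0 <= r by rewrite /r; lra.
have r1 : r < 1 by rewrite /r; lra.
have rw0 : 0 <= r * gap_width t by rewrite mulr_ge0 // ltW.
have rw1 : r * gap_width t < 1 by rewrite (le_lt_trans _ hl) // ler_piMl // ltW.
have E : lo t + r * gap_width t - lo t = r * gap_width t by ring.
rewrite stair_int /stair E floor_itv01 ?rw0 // subr0 mulfK ?gt_eqF // min_r ?ltW //.
by rewrite /r intrD; ring.
Qed.

Lemma stair_continuous : continuous (stair t).
Proof. exact: homo_surj_continuous stair_le stair_surj. Qed.

Lemma stair_le_floor x : stair t x <= (Num.floor (phi x - t))%:~R.
Proof.
have /andP[_ h] := stair_itv x; apply: le_trans h _.
rewrite ler_int floor_ge_int lerBrDr; have /andP[h _] := floor_itv (x - lo t).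
rewrite -(phi_lo (_ + _)); apply: phi_le; rewrite addrC lo_int; lra.
Qed.

(** Together with [stair_le_floor], this sandwiches stair t between
    floor (phi x - t - e) and floor (phi x - t) for every e > 0, which is all that
    Birkhoff averages see. *)
Lemma stair_ge_floor x s : s < phi x - t -> (Num.floor s)%:~R <= stair t x.
Proof.
move=> sx; set k := Num.floor (x - lo t).
have [kx|xk] := ltP (t + k%:~R) (phi x).
  have x1 : hi t + k%:~R <= x.
    rewrite -hi_int; apply/ltW; have /andP[h _] := phiP B x.
    exact: lt_le_trans (hi_lo B kx) h.
  have /andP[_ x2] := floor_itv (x - lo t); rewrite -/k intrD in x2.
  have E : stair t x = k%:~R.
    rewrite -[x](subrK k%:~R) stair_int stair_flat ?add0r //; lra.
  rewrite E ler_int -ltzD1 -(ltr_int R).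
  have /andP[f1 _] := floor_itv s; apply: le_lt_trans f1 _.
  apply: lt_le_trans sx _; rewrite lerBlDl -(phi_lo (_ + _)); apply: phi_le.
  by rewrite lo_int intrD; lra.
have /andP[+ _] := stair_itv x; apply: le_trans; rewrite -/k.
rewrite lerBrDr -[1]/(1%:~R) -intrD ler_int lezD1 -(ltr_int R).
by have /andP[f1 _] := floor_itv s; apply: le_lt_trans f1 _; lra.
Qed.

Lemma stair_cantor x : x = lo (phi x) \/ x = hi (phi x) -> stair t x \is a Num.int.
Proof.
move=> Kx; set k := Num.floor (x - lo t).
have /andP[f1 f2] := floor_itv (x - lo t); rewrite -/k intrD in f1 f2.
rewrite -[x](subrK k%:~R) stair_int rpredD ?intr_int //.
have [h|h] := leP (hi t) (x - k%:~R); first by rewrite stair_flat ?rpred0 //; lra.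
have E : phi x = t + k%:~R by apply: phi_eq; rewrite lo_int hi_int; lra.
have {h E}-> : x - k%:~R = lo t by move: Kx; rewrite E lo_int hi_int; lra.
by rewrite /stair subrr floor0 subr0 mul0r min_r ?ler01 // addr0 add0r rpredN rpred1.
Qed.

End stair.

Hypothesis irr : forall n (m : int), (0 < n)%N -> n%:R * alpha + m%:~R != 0.

(** Translating the argument by s - t changes floor sums of length n by
    n (s - t) up to n e / 2, and the sandwich between floors costs another
    n e / 2. *)
Lemma stair_mean s t (e : R) : lo s < hi s -> lo t < hi t -> 0 < e ->
  exists N, forall n, (N <= n)%N -> forall x,
  `|\sum_(k < n) (stair s (iter k H x) - stair t (iter k H x)) - n%:R * (t - s)| <= n%:R * e.
Proof.
move=> gs gt e0; have e20 : 0 < e / 2 by lra.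
have [N HN] := equidistribution irr e20; exists N => n /HN {}HN x.
have up r : lo r < hi r -> \sum_(k < n) stair r (iter k H x) <= floor_sum alpha n (phi x - r).
  move=> gr; apply: ler_sum => k _; apply: le_trans (stair_le_floor gr _) _.
  by rewrite phi_iter_push addrAC.
have dn r : lo r < hi r -> floor_sum alpha n (phi x - r - e / 2) <= \sum_(k < n) stair r (iter k H x).
  by move=> gr; apply: ler_sum => k _; apply: stair_ge_floor => //; rewrite phi_iter_push; lra.
rewrite sumrB ler_norml.
have := up s gs; have := up t gt; have := dn s gs; have := dn t gt.
have := HN (phi x - s) (phi x - t - e / 2); have := HN (phi x - t) (phi x - s - e / 2).
rewrite (_ : n%:R * (phi x - t - _ + _) = n%:R * (s - t) + n%:R * e); last by field.
rewrite (_ : n%:R * (phi x - s - _ + _) = n%:R * (t - s) + n%:R * e); last by field.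
rewrite -[s - t]opprB mulrN.
by lra.
Qed.

(** * The Cantor set of end points of gaps and of points off the gaps *)
Definition cantor_lift : set R := [set x | x = lo (phi x) \/ x = hi (phi x)].

Lemma cantor_lift_int x (m : int) : cantor_lift x -> cantor_lift (x + m%:~R).
Proof. by rewrite /cantor_lift /= phi_int lo_int hi_int => -[xE|xE]; [left|right]; rewrite {1}xE. Qed.

Lemma cantor_lift_lo t : cantor_lift (lo t).
Proof. by left; rewrite phi_lo. Qed.

Lemma not_cantor_lift x : ~ cantor_lift x <-> exists t, lo t < x < hi t.
Proof.
split=> [nK|[t /andP[h1 h2]] Kx].
  exists (phi x); have /andP[h1 h2] := phiP B x.
  rewrite !lt_neqAle h1 h2 !andbT; apply/andP; split; apply/eqP => E; apply: nK; [left|right] => //.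
have E : phi x = t by apply: phi_eq; rewrite !ltW.
by move: Kx; rewrite /cantor_lift /= E; lra.
Qed.

Lemma closed_cantor_lift : closed cantor_lift.
Proof.
rewrite -[cantor_lift]setCK; apply: open_closedC.
rewrite (_ : ~` _ = \bigcup_t `]lo t, hi t[%classic).
  by apply: bigcup_open => t _; exact: interval_open.
apply/seteqP; split => x /=.
  by move/not_cantor_lift => [t h]; exists t => //=; rewrite in_itv.
by move=> [t _ /=]; rewrite in_itv /= => h; apply/not_cantor_lift; exists t.
Qed.

(** A left end point is approached from the left and a right end point from the
    right, by points over a whole interval of the parameter. *)
Lemma cantor_approach x (e : R) : cantor_lift x -> 0 < e ->
  exists s0 s1, s0 < s1 /\ forall s, s0 < s < s1 -> lo s != x /\ `|lo s - x| < e.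
Proof.
move=> Kx e0; have [xE|xE] := Kx.
- exists (phi (x - e / 2)), (phi x).
  have /andP[h1 h2] := phiP B (x - e / 2).
  have lt : phi (x - e / 2) < phi x.
    rewrite ltNge; apply/negP => h; have E : phi (x - e / 2) = phi x.
      by apply: le_anti; rewrite h phi_le //; lra.
    by move: h1; rewrite E -xE; lra.
  split => // s /andP[/(hi_lo B) s1 /(hi_lo B) s2]; rewrite -xE in s2.
  have s3 := lo_hi B s.
  by split; [rewrite lt_eqF //; lra|rewrite ltr_norml; lra].
- exists (phi x), (phi (x + e / 2)).
  have /andP[h1 h2] := phiP B (x + e / 2).
  have lt : phi x < phi (x + e / 2).
    rewrite ltNge; apply/negP => h; have E : phi (x + e / 2) = phi x.
      by apply: le_anti; rewrite h phi_le //; lra.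
    by move: h2; rewrite E -xE; lra.
  split => // s /andP[/(hi_lo B) s1 /(hi_lo B) s2]; rewrite -xE in s1.
  have s3 := lo_hi B s.
  by split; [rewrite gt_eqF //; lra|rewrite ltr_norml; lra].
Qed.

(** By [dirichlet] the rotation has a return shorter than half the parameter
    interval given by [cantor_approach]. The recurrent point is y, not x: two
    points of the Cantor set near x are needed, one mapped to the other. *)
Lemma cantor_recurrent x (e : R) : cantor_lift x -> 0 < e ->
  exists y n (m : int), [/\ (0 < n)%N, cantor_lift y, `|y - x| < e &
    `|iter n H y + m%:~R - x| < e].
Proof.
move=> Kx e0; have [s0 [s1 [lt h]]] := cantor_approach Kx e0.
have [|n [m [n0 nm]]] := @dirichlet _ alpha ((s1 - s0) / 2); first lra.
exists (lo ((s0 + s1) / 2)), n, m; split => //; first exact: cantor_lift_lo.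
  by have [|] := h ((s0 + s1) / 2); first lra.
rewrite iter_push_lo -lo_int.
have [|_ //] := h ((s0 + s1) / 2 + n%:R * alpha + m%:~R).
by move: nm; rewrite ltr_norml -addrA; lra.
Qed.

Hypothesis g0 : lo 0 < hi 0.

Lemma gap_dense a b : a < b -> exists2 t, a < t < b & lo t < hi t.
Proof.
move=> ab; have [|K0 /(_ a) [k [m [_ h]]]] := @orbit_net _ alpha irr (b - a); first lra.
exists (k%:R * alpha + m%:~R); first by move: h; lra.
rewrite lo_int hi_int ltrD2r -[k%:R * alpha]add0r.
elim: k {h} => [|k IH]; first by rewrite mul0r addr0.
by rewrite (_ : 0 + k.+1%:R * alpha = 0 + k%:R * alpha + alpha) ?gapD // -natr1; ring.
Qed.

Lemma cantor_gap x y : cantor_lift x -> cantor_lift y -> x < y ->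
  exists2 t, lo t < hi t & x <= lo t /\ hi t <= y.
Proof.
move=> Kx Ky xy; have := phi_le (ltW xy); rewrite le_eqVlt => /predU1P[E|].
  exists (phi x); move: Kx Ky; rewrite /cantor_lift /= -E;
  have := lo_hi B (phi x); lra.
move=> /gap_dense[t /andP[t1 t2] gt]; exists t => //.
have := hi_lo B t1; have := hi_lo B t2.
by have /andP[_ h] := phiP B x; have /andP[h' _] := phiP B y; lra.
Qed.

(** Take s in a gap between x and y, and t in a gap between y and x + 1: the first
    staircase rises by one from x to y and the second does not. *)
Lemma cantor_separated x y : cantor_lift x -> cantor_lift y -> x < y < x + 1 ->
  exists s t, [/\ lo s < hi s, lo t < hi t &
    stair s y - stair t y = stair s x - stair t x + 1].
Proof.
move=> Kx Ky /andP[xy yx1].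
have [s gs [s1 s2]] := cantor_gap Kx Ky xy.
have [t gt [t1 t2]] := cantor_gap Ky (cantor_lift_int 1 Kx) yx1.
have flat r z (m : int) : lo r < hi r -> hi r <= z + m%:~R <= lo r + 1 -> stair r z = - m%:~R.
  by move=> gr /(stair_flat gr); rewrite stair_int; lra.
exists s, t; split => //.
rewrite (flat s y 0) ?(flat s x 1) ?(flat t y 1) ?(flat t x 1) //; try (move: s1 s2 t1 t2; rewrite ?addr0; lra).
Qed.

End blowup_theory.

(** * Maps of the torus induced by maps of the plane *)

(** Products of quotient maps need not be quotient maps, but the projection onto
    the circle is open, and openness passes to products. *)
Section open_quotients.
Variables (X Y Z : topologicalType) (p : X -> Y).

Definition open_at_points := forall x U, nbhs x U -> nbhs (p x) (p @` U).

Lemma continuous_open_quotient (g : Y -> Z) :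
  open_at_points -> (forall y, exists x, p x = y) -> continuous (g \o p) -> continuous g.
Proof.
move=> op ps gp y W gW; have [x xy] := ps y.
have := gp x W; rewrite /= xy => /(_ gW) /op; rewrite xy.
by apply: filterS => _ [x' /= gx' <-].
Qed.

End open_quotients.

Lemma open_pair (X Y X' Y' : topologicalType) (p : X -> Y) (q : X' -> Y') :
  open_at_points p -> open_at_points q ->
  open_at_points (fun z => (p z.1, q z.2)).
Proof.
move=> op oq [x x'] U [[U1 U2] /= [/op nU1 /oq nU2] U12].
exists (p @` U1, q @` U2) => //= -[_ _] /= [[a Ua <-] [b Ub <-]].
by exists (a, b) => //; exact: U12.
Qed.

Lemma cvg_pair_nbhs (T : Type) (X Y : topologicalType) (F : set_system T) {FF : Filter F}
    (f : T -> X) (g : T -> Y) (x : X) (y : Y) :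
  f t @[t --> F] --> x -> g t @[t --> F] --> y -> (f t, g t) @[t --> F] --> (x, y).
Proof. by move=> fx gy; exact: (cvg_pair fx gy). Qed.

Section circle.
Variable R : realType.

Lemma circle_projP (x y : R) :
  circle_proj x = circle_proj y <-> exists m : int, x = y + m%:~R.
Proof.
split=> [/eqquotP /intrP[m E]|[m ->]].
  by exists m; rewrite -E addrC subrK.
by apply/eqquotP; rewrite /= /eq_mod1 addrAC subrr add0r intr_int.
Qed.

Lemma circle_proj_int (x : R) (m : int) : circle_proj (x + m%:~R) = circle_proj x.
Proof. by apply/circle_projP; exists m. Qed.

Definition circle_rep (c : circle R) : R :=
  @repr _ {eq_quot (eq_mod1_equiv R)} c.

Lemma circle_repK c : circle_proj (circle_rep c) = c.
Proof. exact: reprK. Qed.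

Lemma circle_proj_surj (c : circle R) : exists x, circle_proj x = c.
Proof. by exists (circle_rep c); exact: circle_repK. Qed.

Lemma circle_proj_continuous : continuous (@circle_proj R).
Proof. exact: pi_continuous. Qed.

Lemma open_circle_image (U : set R) : open U -> open (@circle_proj R @` U).
Proof.
move=> oU; have -> : open (@circle_proj R @` U) = open (@circle_proj R @^-1` (@circle_proj R @` U)) by [].
rewrite (_ : _ @^-1` _ = \bigcup_(m : int) (fun x => x + m%:~R) @^-1` U).
  apply: bigcup_open => m _; apply: open_comp => // x _.
  by apply: cvgD; [exact: cvg_id|exact: cvg_cst].
apply/seteqP; split => x /=.
  by move=> [y Uy /circle_projP[m yE]]; exists m => //=; rewrite -yE.
by move=> [m _ /= Ux]; exists (x + m%:~R) => //; exact: circle_proj_int.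
Qed.

(** The saturation of an open set is the union of its integer translates. *)
Lemma circle_proj_open : open_at_points (@circle_proj R).
Proof.
move=> x U; rewrite nbhsE => -[V [oV Vx] VU].
apply: (@filterS _ _ _ (@circle_proj R @` V)); first exact: image_subset.
by apply: open_nbhs_nbhs; split; [exact: open_circle_image|exists x].
Qed.

Lemma torus_proj_open : open_at_points (@torus_proj R).
Proof. exact: open_pair circle_proj_open circle_proj_open. Qed.

Lemma torus_proj_surj (p : torus R) : exists z, torus_proj z = p.
Proof.
by exists (circle_rep p.1, circle_rep p.2); rewrite /torus_proj /= !circle_repK; case: p.
Qed.

Lemma torus_proj_continuous : continuous (@torus_proj R).
Proof.
move=> z; apply: cvg_pair_nbhs.
  by apply: cvg_comp; [exact: cvg_fst|exact: circle_proj_continuous].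
by apply: cvg_comp; [exact: cvg_snd|exact: circle_proj_continuous].
Qed.

Lemma circle_nbhs_ball (x : R) (U : set (circle R)) : nbhs (circle_proj x) U ->
  exists2 e : R, 0 < e & forall y, `|y - x| < e -> U (circle_proj y).
Proof.
move=> /circle_proj_continuous /nbhs_ballP[e e0 H]; exists e => // y yx.
by apply: H; rewrite -ball_normE /= distrC.
Qed.

Definition descend (F : R * R -> R * R) (p : torus R) : torus R :=
  torus_proj (F (circle_rep p.1, circle_rep p.2)).

Definition skew_product (h b : R -> R) (z : R * R) : R * R := (h z.1, z.2 + b z.1).

Section skew_products.
Variables h b : R -> R.
Hypothesis h_int : forall x (m : int), h (x + m%:~R) = h x + m%:~R.
Hypothesis b_int : forall x (m : int), b (x + m%:~R) = b x.

Lemma descend_skew_product z : descend (skew_product h b) (torus_proj z) = torus_proj (skew_product h b z).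
Proof.
rewrite /descend /skew_product /torus_proj /=.
have [m ->] := (circle_projP _ _).1 (circle_repK (circle_proj z.1)).
have [n ->] := (circle_projP _ _).1 (circle_repK (circle_proj z.2)).
by rewrite h_int b_int addrAC !circle_proj_int.
Qed.

Lemma iter_descend n z :
  iter n (descend (skew_product h b)) (torus_proj z) = torus_proj (iter n (skew_product h b) z).
Proof. by elim: n => // n IH; rewrite !iterS IH descend_skew_product. Qed.

Lemma iter_skew_product n z :
  iter n (skew_product h b) z = (iter n h z.1, z.2 + \sum_(k < n) b (iter k h z.1)).
Proof.
elim: n => [|n IH]; first by rewrite big_ord0 addr0; case: z.
by rewrite iterS IH big_ord_recr /= addrA.
Qed.

Hypothesis h_cont : continuous h.
Hypothesis b_cont : continuous b.

Lemma skew_product_continuous : continuous (skew_product h b).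
Proof.
move=> z; apply: cvg_pair_nbhs; first by apply: cvg_comp; [exact: cvg_fst|exact: h_cont].
by apply: cvgD; [exact: cvg_snd|apply: cvg_comp; [exact: cvg_fst|exact: b_cont]].
Qed.

Lemma descend_skew_product_continuous : continuous (descend (skew_product h b)).
Proof.
apply: continuous_open_quotient torus_proj_open torus_proj_surj _.
rewrite (_ : _ \o _ = @torus_proj R \o skew_product h b); last by apply/funext => z /=; exact: descend_skew_product.
by move=> z; apply: continuous_comp; [exact: skew_product_continuous|exact: torus_proj_continuous].
Qed.

End skew_products.

(** The homotopy is affine in the lift; it need not go through homeomorphisms. *)
Lemma Homeo0_skew_product (h k b : R -> R) :
  (forall x (m : int), h (x + m%:~R) = h x + m%:~R) ->
  (forall x (m : int), k (x + m%:~R) = k x + m%:~R) ->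
  (forall x (m : int), b (x + m%:~R) = b x) ->
  continuous h -> continuous k -> continuous b ->
  cancel h k -> cancel k h -> Homeo0 (descend (skew_product h b)).
Proof.
move=> h_int k_int b_int hc kc bc hK kK; split.
  split; first exact: descend_skew_product_continuous.
  pose b' x := - b (k x).
  have b'_int x (m : int) : b' (x + m%:~R) = b' x by rewrite /b' k_int b_int.
  have bc' : continuous b'.
    by move=> x; apply: cvgN; apply: cvg_comp; [exact: kc|exact: bc].
  exists (descend (skew_product k b')); split.
  - exact: descend_skew_product_continuous.
  - move=> p; have [z <-] := torus_proj_surj p; rewrite !descend_skew_product //.
    by rewrite /skew_product /b' /= !hK addrK; case: z.
  - move=> p; have [z <-] := torus_proj_surj p; rewrite !descend_skew_product //.
    by rewrite /skew_product /b' /= !kK subrK; case: z.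
pose hs s x := (1 - s) * h x + s * x.
pose bs s x := (1 - s) * b x.
have hs_int s x (m : int) : hs s (x + m%:~R) = hs s x + m%:~R by rewrite /hs h_int; ring.
have bs_int s x (m : int) : bs s (x + m%:~R) = bs s x by rewrite /bs b_int.
exists (fun q => descend (skew_product (hs q.1) (bs q.1)) q.2); split.
- apply: continuous_subspaceT.
  apply: (@continuous_open_quotient (R * (R * R))%type _ _ (fun q => (q.1, torus_proj q.2))).
  + apply: (@open_pair _ _ _ _ idfun) torus_proj_open => x U nU.
    by rewrite image_id.
  + by move=> [s p]; have [z <-] := torus_proj_surj p; exists (s, z).
  rewrite (_ : _ \o _ = @torus_proj R \o fun q => skew_product (hs q.1) (bs q.1) q.2); last first.
    by apply/funext => q /=; exact: descend_skew_product.
  move=> q; apply: continuous_comp; last exact: torus_proj_continuous.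
  have c1 : (fst q' : R) @[q' --> q] --> q.1 by exact: cvg_fst.
  have c2 : (q'.2.1 : R) @[q' --> q] --> q.2.1.
    by apply: cvg_comp; [exact: cvg_snd|exact: cvg_fst].
  have c3 : (q'.2.2 : R) @[q' --> q] --> q.2.2.
    by apply: cvg_comp; [exact: cvg_snd|exact: cvg_snd].
  have c4 : (1 - q'.1 : R) @[q' --> q] --> 1 - q.1 by apply: cvgB c1; exact: cvg_cst.
  apply: cvg_pair_nbhs => /=.
    apply: cvgD; apply: cvgM => //.
    by apply: cvg_comp c2 _; exact: hc.
  apply: cvgD => //; apply: cvgM => //.
  by apply: cvg_comp c2 _; exact: bc.
- move=> p; have [z <-] := torus_proj_surj p; rewrite !descend_skew_product //.
  by rewrite /skew_product /hs /bs /= subr0 !mul1r mul0r addr0.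
- move=> p; have [z <-] := torus_proj_surj p; rewrite !descend_skew_product //.
  by rewrite /skew_product /hs /bs /= subrr !mul0r !mul1r add0r addr0; case: z.
Qed.

(** Uniform convergence of the mean displacements bears on all sequences of points
    and times at once. *)
Lemma rotation_set_uniform (F : R * R -> R * R) (a b : R) :
  (forall e : R, 0 < e -> exists N, forall n, (N <= n)%N -> forall z,
     `|(mean_displacement F n z).1 - a| < e /\ `|(mean_displacement F n z).2 - b| < e) ->
  rotation_set F = [set (a, b)].
Proof.
move=> unif.
have key n (z : nat -> R * R) : n i @[i --> \oo] --> \oo ->
    mean_displacement F (n i) (z i) @[i --> \oo] --> (a, b).
  move=> noo.
  have nN e : 0 < e -> \forall i \near \oo,
      `|(mean_displacement F (n i) (z i)).1 - a| < e /\ `|(mean_displacement F (n i) (z i)).2 - b| < e.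
    move=> /unif[N HN]; have nN : \forall i \near \oo, (N <= n i)%N.
      exact: noo _ (nbhs_infty_ge N).
    by apply: filterS nN => i /HN.
  by apply: cvg_pair_nbhs; apply/cvgrPdist_lt => e /nN; apply: filterS => i [h1 h2];
    rewrite distrC.
apply/seteqP; split => v /=.
  move=> [n [z [noo zv]]].
  exact: (@cvg_unique _ (@norm_hausdorff _ (R * R)%type) _ _ _ _ zv (key n z noo)).
move=> ->; exists id, (fun=> (0, 0)); split; first exact: cvg_id.
exact/key/cvg_id.
Qed.

End circle.

(** * The Cantor set in the circle *)
Section cantor_circle.
Variables (R : realType) (alpha : R) (B : blowup alpha).
Hypothesis irr : forall n (m : int), (0 < n)%N -> n%:R * alpha + m%:~R != 0.
Hypothesis g0 : lo B 0 < hi B 0.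

Definition cantor_circle : set (circle R) := @circle_proj R @` cantor_lift B.
Local Notation C := cantor_circle.
Local Notation H := (push B alpha).

Lemma cantor_circleP x : C (circle_proj x) <-> cantor_lift B x.
Proof.
split=> [[y Ky /circle_projP[m yE]]|Kx]; last by exists x.
by rewrite (_ : x = y + (- m)%:~R); [exact: cantor_lift_int|rewrite yE rmorphN /= addrK].
Qed.

Lemma cantor_circle_iter n x : cantor_lift B x -> cantor_lift B (iter n H x).
Proof. by move=> Kx; elim: n => // n IH; apply: cantor_push => //; exact: gapD. Qed.

Lemma closed_cantor_circle : closed C.
Proof.
rewrite -[C]setCK; apply: open_closedC.
have -> : open (~` C) = open (@circle_proj R @^-1` (~` C)) by [].
rewrite (_ : _ @^-1` _ = ~` cantor_lift B).
  by apply: closed_openC; exact: closed_cantor_lift.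
by apply/seteqP; split => x /= h /cantor_circleP.
Qed.

(** The Cantor set is already the image of the points of its lift in [0, 1]. *)
Lemma compact_cantor_circle : compact C.
Proof.
rewrite (_ : C = @circle_proj R @` (`[0, 1]%classic `&` cantor_lift B)).
  apply: continuous_compact.
    by apply: continuous_subspaceT; exact: circle_proj_continuous.
  by apply: compact_closedI; [exact: segment_compact|exact: closed_cantor_lift].
apply/seteqP; split => [c [x Kx <-]|]; last by apply: image_subset => x [].
exists (x + (- Num.floor x)%:~R); last exact: circle_proj_int.
split; last exact: cantor_lift_int.
by rewrite /= in_itv /= rmorphN /=; have := floor_itv x; rewrite intrD; lra.
Qed.

Lemma limit_point_cantor_circle : limit_point C = C.
Proof.
apply/seteqP; split => c.
  move=> lc; apply: closed_cantor_circle => U /lc[y [_ Cy Uy]].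
  by exists y.
move=> [x Kx <-] U /circle_nbhs_ball[e e0 HU].
have [|s0 [s1 [lt h]]] := cantor_approach Kx (e := Num.min e 1).
  by rewrite lt_min e0 ltr01.
have [|nx] := h ((s0 + s1) / 2); first lra.
rewrite lt_min => /andP[lte lt1].
exists (circle_proj (lo B ((s0 + s1) / 2))); split.
- apply/eqP => /circle_projP[m E]; move: nx lt1; rewrite E addrAC subrr add0r.
  rewrite -intr_norm -[1]/(1%:~R) ltr_int -[X in _ != X]addr0.
  rewrite (inj_eq (addrI x)) intr_eq0; lia.
- by exists (lo B ((s0 + s1) / 2)) => //; exact: cantor_lift_lo.
- exact: HU.
Qed.

Lemma stair_sub_int s t x (m : int) :
  stair B s (x + m%:~R) - stair B t (x + m%:~R) = stair B s x - stair B t x.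
Proof. by rewrite !stair_int; ring. Qed.

(** The difference of two staircases is a continuous function on the circle with
    integer values on the Cantor set; it is constant on a connected subset, and
    [cantor_separated] provides differences that distinguish two given points. *)
Lemma totally_disconnected_cantor_circle : totally_disconnected C.
Proof.
move=> c Cc; apply/seteqP; split => [d|_ ->]; last exact: connected_component_refl.
move=> cd; have Cd : C d := connected_component_sub cd.
move: Cc cd => [x Kx <-] cd; move: Cd cd => [y0 Ky0 <-] cd.
pose y := y0 + (Num.floor (x - y0) + 1)%:~R.
have Ky : cantor_lift B y by exact: cantor_lift_int.
have yE : circle_proj y0 = circle_proj y by rewrite circle_proj_int.
have := floor_itv (x - y0); rewrite intrD => /andP[f1 f2].
have xy : x < y by rewrite /y intrD; lra.
have yx1 : y <= x + 1 by rewrite /y intrD; lra.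
move: yx1; rewrite le_eqVlt => /predU1P[y1|yx1].
  by rewrite /= yE y1 -[1]/(1%:~R) circle_proj_int.
have [|s [t [gs gt E]]] := cantor_separated irr g0 Kx Ky; first by rewrite xy.
pose u (c : circle R) := stair B s (circle_rep c) - stair B t (circle_rep c).
have uE z : u (circle_proj z) = stair B s z - stair B t z.
  rewrite /u; have [m ->] := (circle_projP _ _).1 (circle_repK (circle_proj z)).
  exact: stair_sub_int.
have uc : continuous u.
  apply: continuous_open_quotient (@circle_proj_open R) (@circle_proj_surj R) _.
  rewrite (_ : _ \o _ = fun z => stair B s z - stair B t z); last by apply/funext => z /=.
  by move=> z; apply: cvgB; exact: stair_continuous.
have /connected_intervalP itv : connected (u @` connected_component C (circle_proj x)).
  by apply: connected_continuous_connected; [exact: component_connected|exact: continuous_subspaceT].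
have ux : (u @` connected_component C (circle_proj x)) (u (circle_proj x)).
  by exists (circle_proj x) => //; apply: connected_component_refl; exact/cantor_circleP.
have uy : (u @` connected_component C (circle_proj x)) (u (circle_proj y)).
  by exists (circle_proj y) => //; rewrite -yE.
(* the intermediate value would be an integer plus one half *)
have [|w cw uw] := itv _ _ ux uy (u (circle_proj x) + 1 / 2).
  by rewrite !uE E; lra.
have Zu z : cantor_lift B z -> u (circle_proj z) \is a Num.int.
  by move=> Kz; rewrite uE rpredB // stair_cantor.
have [z Kz zE] := connected_component_sub cw.
have : (1 / 2 : R) \is a Num.int.
  rewrite (_ : 1 / 2 = u w - u (circle_proj x)); last by rewrite uw; ring.
  by rewrite -zE rpredB // Zu.
move=> /intrP[m /eqP]; rewrite div1r -(inj_eq (mulfI (_ : 2 != 0 :> R))) ?pnatr_eq0 // divff ?pnatr_eq0 //.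
rewrite -[1]/(1%:~R) -[2]/(2%:~R) -intrM eqr_int; lia.
Qed.

Lemma cantor_set_cantor_circle : cantor_set C.
Proof.
split.
- by exists (circle_proj (lo B 0)); apply/cantor_circleP; exact: cantor_lift_lo.
- exact: compact_cantor_circle.
- by split; [exact: closed_cantor_circle|exact: limit_point_cantor_circle].
- exact: totally_disconnected_cantor_circle.
Qed.

Variable gamma : R.
Hypothesis gg : lo B gamma < hi B gamma.

(** * The skew product *)
Definition twist x := stair B 0 x - stair B gamma x.
Local Notation f := (descend (skew_product H twist)).

Let H_int x (m : int) : H (x + m%:~R) = H x + m%:~R.
Proof. exact: push_int. Qed.

Let twist_int x (m : int) : twist (x + m%:~R) = twist x.
Proof. exact: stair_sub_int. Qed.

(** Over the Cantor set the skew product acts as the identity on fibres, because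
    the values of [twist] there are integers. *)
Lemma iter_f_cantor_lift n (x y : R) : cantor_lift B x ->
  iter n f (circle_proj x, circle_proj y) = (circle_proj (iter n H x), circle_proj y).
Proof.
move=> Kx; rewrite -[(_, _)]/(torus_proj (x, y)) iter_descend // iter_skew_product.
rewrite /torus_proj /=; congr (_, _).
have : \sum_(k < n) twist (iter k H x) \is a Num.int.
  apply: rpred_sum => k _; have := cantor_circle_iter k Kx => Kk.
  by rewrite rpredB // stair_cantor.
by move=> /intrP[m ->]; exact: circle_proj_int.
Qed.

(** A gap that returned to itself modulo 1 after n steps would make n alpha an
    integer, so points over gaps wander. Over the Cantor set, recurrence in the
    base suffices since the fibre coordinate is fixed. *)
Lemma nonwandering_f : nonwandering_set f = C `*` [set: circle R].
Proof.
apply/seteqP; split => -[c d] /=.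
  move=> nw; split => //=; have [x xc] := circle_proj_surj c; subst c.
  apply/cantor_circleP; apply: contrapT => /not_cantor_lift[t xt].
  pose I := `]lo B t, hi B t[%classic : set R.
  have nU : nbhs (circle_proj x, d) (fst @^-1` (@circle_proj R @` I)).
    apply: cvg_fst; apply: circle_proj_open; apply: open_nbhs_nbhs; split.
      exact: interval_open.
    by rewrite /I /= in_itv.
  have [n n0 [_ [[[c' d'] /= [y yI yc] <-]]]] := nw _ nU; rewrite -{}yc {c'}.
  have [y' <-] := circle_proj_surj d'.
  rewrite -[(circle_proj y, _)]/(torus_proj (y, y')) iter_descend // iter_skew_product.
  move=> /= [z zI /circle_projP[m E]].
  move: yI zI; rewrite /I /= !in_itv /= => yI zI.
  have py : phi B y = t by apply: phi_eq; move: yI; lra.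
  have pz : phi B z = t by apply: phi_eq; have := zI; lra.
  have := congr1 (phi B) E; rewrite phi_int phi_iter_push pz py => E'.
  have /eqP[] := irr m n0; lra.
move=> [Cc _] U; have [x xc] := circle_proj_surj c; subst c; have [y yd] := circle_proj_surj d; subst d.
move=> [[U1 U2] /= [nU1 nU2] U12]; have [e e0 HU1] := circle_nbhs_ball nU1.
have Kx : cantor_lift B x by exact/cantor_circleP.
have [x' [n [m [n0 Kx' xx' rx']]]] := cantor_recurrent Kx e0.
exists n => //; exists (circle_proj (iter n H x'), circle_proj y); split.
  exists (circle_proj x', circle_proj y); last exact: iter_f_cantor_lift.
  by apply: U12; split => /=; [exact: HU1|exact: nbhs_singleton].
apply: U12; split => /=; last exact: nbhs_singleton.
by rewrite -(circle_proj_int _ m); exact: HU1.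
Qed.

(** The fibre coordinate is invariant over the Cantor set, so two disjoint arcs of
    fibre coordinates are never joined by an orbit. *)
Lemma not_transitive_f : ~ transitive_on f (nonwandering_set f).
Proof.
rewrite nonwandering_f => tr.
pose arc a b : set (torus R) := snd @^-1` (@circle_proj R @` `]a, b[%classic).
have arc_open a b : open (arc a b).
  apply: open_comp => [p _|]; first exact: cvg_snd.
  by apply: open_circle_image; exact: interval_open.
have arc_meet a b : a < b -> (C `*` setT) `&` arc a b !=set0.
  move=> ab; exists (circle_proj (lo B 0), circle_proj ((a + b) / 2)); split.
    by split => //=; apply/cantor_circleP; exact: cantor_lift_lo.
  by exists ((a + b) / 2) => //=; rewrite in_itv /=; lra.
have a1 : 0 < 1 / 2 :> R by lra.
have a2 : 1 / 2 < 1 :> R by lra.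
have [n n0 [_ [[[c d] [[/= Cc _] Ad] <-] [_ Ad']]]] :=
  tr _ _ (arc_open 0 (1 / 2)) (arc_open (1 / 2) 1) (arc_meet _ _ a1) (arc_meet _ _ a2).
have [x Kx xc] := Cc; have [y yI yd] := Ad; rewrite /= in yd.
move: Ad'; rewrite -xc -yd iter_f_cantor_lift // => -[/= z zI /circle_projP[m E]].
move: yI zI; rewrite /= !in_itv /= E => yI zI.
have m0 : (0 < m)%R by rewrite -(ltr_int R) mulr0z; lra.
have m1 : (m < 1)%R by rewrite -(ltr_int R) mulr1z; lra.
by move: m0 m1; lia.
Qed.

Lemma Homeo0_f : Homeo0 f.
Proof.
apply: (@Homeo0_skew_product _ _ (push B (- alpha))) => //.
- by move=> x m; exact: push_int.
- exact: push_alpha_continuous.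
- exact: push_opp_continuous.
- by move=> x; apply: cvgB; exact: stair_continuous.
- exact: push_alphaK.
- exact: push_oppK.
Qed.

(** The first coordinate deviates from the rotation by a bounded amount
    ([iter_push_near]); the second one is the Birkhoff sum of [twist]. *)
Lemma rotation_set_f : rotation_set (skew_product H twist) = [set (alpha, gamma)].
Proof.
apply: rotation_set_uniform => e e0; have e20 : 0 < e / 2 by lra.
have [N HN] := stair_mean irr g0 gg e20.
pose c := 2 * (`|phi B 0| + 1).
exists (maxn N (Num.truncn (c / e)).+1) => n; rewrite geq_max => /andP[Nn cn] z.
have n0 : 0 < n%:R :> R by rewrite ltr0n (leq_trans _ cn).
have cne : c < n%:R * e.
  rewrite -ltr_pdivrMr // (lt_le_trans (truncnS_gt _)) // ler_nat //.
rewrite /mean_displacement iter_skew_product /=.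
have dist (u v d : R) : `|u - n%:R * v| < n%:R * d -> `|u / n%:R - v| < d.
  move=> h; rewrite -(ltr_pM2l n0) -[X in X * `|_|](gtr0_norm n0) -normrM.
  by rewrite mulrBr mulrCA divff ?mulr1 // gt_eqF.
split; apply: dist.
  by apply: le_lt_trans cne; exact: iter_push_near.
rewrite [z.2 + _]addrC addrK; apply: (@le_lt_trans _ _ (n%:R * (e / 2))).
  by have := HN n Nn z.1; rewrite subr0.
by rewrite ltr_pM2l //; lra.
Qed.

End cantor_circle.

Theorem mainTheorem4 (R : realType) :
  exists (f : torus R -> torus R) (C : set (circle R)),
    [/\ non_resonant f, cantor_set C,
        nonwandering_set f = C `*` [set: circle R] &
        ~ transitive_on f (nonwandering_set f)].
Proof.
pose alpha : R := Num.sqrt 2; pose gamma : R := Num.sqrt 3.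
have indep : rationally_independent alpha gamma.
  exact: rationally_independent_sqrt.
have irr n (m : int) : (0 < n)%N -> n%:R * alpha + m%:~R != 0.
  move=> n0; apply/eqP => E; have [|_ /eqP + _] := indep m%:~R n%:R 0.
    by rewrite ratr_int ratr_nat rmorph0 mul0r addr0 addrC.
  by rewrite pnatr_eq0; lia.
have [B [g0 gg]] := exists_blowup alpha gamma.
exists (descend (skew_product (push B alpha) (twist B gamma))), (cantor_circle B); split.
- split; first exact: Homeo0_f.
  exists (skew_product (push B alpha) (twist B gamma)), alpha, gamma; split => //.
    split; last by move=> z; rewrite descend_skew_product //; [exact: push_int|exact: stair_sub_int].
    apply: skew_product_continuous; first exact: push_alpha_continuous.
    by move=> x; apply: cvgB; exact: stair_continuous.
  exact: rotation_set_f.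
- exact: cantor_set_cantor_circle.
- exact: nonwandering_f.
- exact: not_transitive_f.
Qed.
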